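(* Let $G$ be a Lie group that is a closed subgroup of its universal complexification, and let $X$ be a CR manifold with a transversal, proper CR action of $G$. Equip $X/G$ with the complex space structure whose sheaf of holomorphic functions is the sheaf of $G$-invariant CR functions on $X$. Then the quotient $X/G$ is universal: every $G$-invariant CR map $f\colon X\to Y$ into a complex manifold $Y$ factorises uniquely over a holomorphic map on $X/G$, i.e. there is a unique holomorphic map $\bar f\colon X/G\to Y$ with $f=\bar f\circ\pi$, where $\pi\colon X\to X/G$ is the quotient map.
   Context: A CR manifold is a smooth manifold $X$ with a smooth complex subbundle $T^{1,0}X\subset \mathbb C TX$ of the complexified tangent bundle such that $T^{1,0}X\cap \overline{T^{1,0}X}=\{0\}$ and $\Gamma(U,T^{1,0}X)$ is closed under Lie brackets for every open $U$; $T^{0,1}X:=\overline{T^{1,0}X}$. A smooth map $f$ between CR manifolds is CR if $df(T^{1,0})\subset T^{1,0}$; a CR function is a CR map to $\mathbb C$. An action of a Lie group on $X$ is CR if each group element acts by a CR automorphism. For a Lie group $G$ with Lie algebra $\mathfrak g$ acting on $X$, $\mathfrak g(x)\subset T_xX$ is the span of the values at $x$ of the fundamental vector fields and $\mathbb C\mathfrak g(x)$ its complex span in $\mathbb C T_xX$. The action is transversal if $\mathbb C\mathfrak g(x)\oplus T^{1,0}_xX\oplus T^{0,1}_xX=\mathbb C T_xX$ for all $x\in X$. The universal complexification $G^{\mathbb C}$ of $G$ is the complex Lie group with a homomorphism $G\to G^{\mathbb C}$ through which every Lie group homomorphism from $G$ to a complex Lie group factors via a unique holomorphic homomorphism. ''$G$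 is a (closed) subgroup of $G^{\mathbb C}$'' means that $G\to G^{\mathbb C}$ is injective (with closed image). Under these hypotheses, $X/G$ with the sheaf $U\mapsto\{f\colon\pi^{-1}(U)\to\mathbb C\mid f\text{ CR and }G\text{-invariant}\}$ is a complex space. *)

(* Defs.v *)
From HB Require Import structures.
From mathcomp Require Import all_boot all_order all_algebra.
From mathcomp Require Import all_classical all_reals all_analysis.
From mathcomp Require Import complex lra.

Set Implicit Arguments.
Unset Strict Implicit.
Unset Printing Implicit Defensive.
Import Order.TTheory GRing.Theory Num.Theory numFieldNormedType.Exports.
Local Open Scope classical_set_scope.
Local Open Scope ring_scope.
Local Open Scope complex_scope.
Local Open Scope quotient_scope.

Section Calculus.
Context {R : realType}.

(* [U] is meant to be open. *)
Fixpoint Ck (V W : normedModType R) (k : nat) (U : set V) (f : V -> W) : Prop :=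
  match k with
  | 0%N => forall x, U x -> {for x, continuous f}
  | k'.+1 => (forall x, U x -> differentiable f x) /\
             (forall v : V, Ck k' U (fun x => 'd f x v))
  end.

Definition Cinfty (V W : normedModType R) (U : set V) (f : V -> W) : Prop :=
  forall k, Ck k U f.

(* C^n is identified with R^(n + n) by z |-> (Re z, Im z); then [Jmul] is the
   multiplication by the imaginary unit. *)
Definition Jmul n (v : 'rV[R]_(n + n)) : 'rV[R]_(n + n) :=
  row_mx (- rsubmx v) (lsubmx v).

(* The imaginary unit of C^m x C^n, the factors being encoded as above. *)
Definition Jmul2 m n (v : 'rV[R]_((m + m) + (n + n))) :
    'rV[R]_((m + m) + (n + n)) :=
  row_mx (Jmul (lsubmx v)) (Jmul (rsubmx v)).

(* Holomorphic = smooth with complex linear differential, the complex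
   structures of the real spaces [V] and [W] being given by [JV] and [JW]. *)
Definition holo (V W : normedModType R) (JV : V -> V) (JW : W -> W)
    (U : set V) (f : V -> W) : Prop :=
  Cinfty U f /\ forall x v, U x -> 'd f x (JV v) = JW ('d f x v).

Lemma Ck_cst (V W : normedModType R) k (U : set V) (c : W) :
  Ck k U (fun _ : V => c).
Proof.
elim: k c => [|k IHk] c /=; first by move=> x _; exact: cst_continuous.
split=> [x _|v]; first exact: differentiable_cst.
rewrite (_ : (fun x => _) = fun=> 0) //.
by apply/funext => x; rewrite diff_cst.
Qed.

Lemma holo_id (V : normedModType R) (JV : V -> V) (U : set V) (f : V -> V) :
  f =1 id -> holo JV JV U f.
Proof.
move=> /funext ->; split=> [[|k]|x v _] /=.
- by move=> x _; exact: cvg_id.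
- split=> [x _|v]; first exact: ex_diff.
  rewrite (_ : (fun x => _) = fun=> v); first exact: Ck_cst.
  by apply/funext => x; rewrite diff_val.
- by rewrite diff_val.
Qed.

End Calculus.

Section Manifolds.
Context {R : realType}.

Record chart (T : topologicalType) (n : nat) := Chart {
  chart_dom : set T;
  chart_map :> T -> 'rV[R]_n;
  chart_inv : 'rV[R]_n -> T;
  chart_dom_open : open chart_dom;
  chart_img_open : open (chart_map @` chart_dom);
  chartK : forall x, chart_dom x -> chart_inv (chart_map x) = x;
  chart_map_cts : forall x, chart_dom x -> {for x, continuous chart_map};
  chart_inv_cts :
    forall v, (chart_map @` chart_dom) v -> {for v, continuous chart_inv}
}.

Record smoothManifold (n : nat) := SmoothManifold {
  mfd_top :> topologicalType;
  atlas : set (chart mfd_top n);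
  mfd_hausdorff : hausdorff_space mfd_top;
  mfd_second_countable : @second_countable mfd_top;
  atlas_cover : forall x, exists2 a, atlas a & chart_dom a x;
  atlas_smooth : forall a b, atlas a -> atlas b ->
    Cinfty (a @` (chart_dom a `&` chart_dom b)) (b \o chart_inv a)
}.

Definition holomorphic_atlas n (M : smoothManifold (n + n)) : Prop :=
  forall a b, atlas (s := M) a -> atlas b ->
    holo (@Jmul R n) (@Jmul R n)
      (a @` (chart_dom a `&` chart_dom b)) (b \o chart_inv a).

Record complexManifold (n : nat) := ComplexManifold {
  cmfd_smooth :> smoothManifold (n + n);
  cmfd_holo : holomorphic_atlas cmfd_smooth
}.

(* In the definitions "on U" below, U is meant to be open. *)
Definition smooth_on m n (M : smoothManifold m) (N : smoothManifold n)
    (U : set M) (f : M -> N) : Prop :=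
  (forall x, U x -> {for x, continuous f}) /\
  forall a b, atlas a -> atlas b ->
    Cinfty (a @` (U `&` chart_dom a `&` f @^-1` chart_dom b))
           (b \o f \o chart_inv a).

Definition holo_on m n (M : complexManifold m) (N : complexManifold n)
    (U : set M) (f : M -> N) : Prop :=
  (forall x, U x -> {for x, continuous f}) /\
  forall a b, atlas a -> atlas b ->
    holo (@Jmul R m) (@Jmul R n)
      (a @` (U `&` chart_dom a `&` f @^-1` chart_dom b))
      (b \o f \o chart_inv a).

(* The coordinate expression, in the product chart a x b of M x N and the chart
   c of P, of a map M x N -> P, and its domain. *)
Definition coord2 m n p (M : smoothManifold m) (N : smoothManifold n)
    (P : smoothManifold p) (f : M -> N -> P) (a : chart M m) (b : chart N n)
    (c : chart P p) (v : 'rV[R]_(m + n)) : 'rV[R]_p :=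
  c (f (chart_inv a (lsubmx v)) (chart_inv b (rsubmx v))).

Definition coord2_dom m n p (M : smoothManifold m) (N : smoothManifold n)
    (P : smoothManifold p) (f : M -> N -> P) (a : chart M m) (b : chart N n)
    (c : chart P p) : set 'rV[R]_(m + n) :=
  [set v | exists x y, [/\ chart_dom a x, chart_dom b y,
                           chart_dom c (f x y) & v = row_mx (a x) (b y)]].

Definition smooth2 m n p (M : smoothManifold m) (N : smoothManifold n)
    (P : smoothManifold p) (f : M -> N -> P) : Prop :=
  continuous (fun z : M * N => f z.1 z.2) /\
  forall a b c, atlas a -> atlas b -> atlas c ->
    Cinfty (coord2_dom f a b c) (coord2 f a b c).

Definition holo2 m n p (M : complexManifold m) (N : complexManifold n)
    (P : complexManifold p) (f : M -> N -> P) : Prop :=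
  continuous (fun z : M * N => f z.1 z.2) /\
  forall a b c, atlas a -> atlas b -> atlas c ->
    holo (@Jmul2 R m n) (@Jmul R p) (coord2_dom f a b c) (coord2 f a b c).

End Manifolds.
Arguments chart R T n : clear implicits.
Arguments smoothManifold R n : clear implicits.
Arguments complexManifold R n : clear implicits.

Section ComplexLine.
Context (R : realType).

Definition cline_coord (z : R[i]^o) : 'rV[R]_(1 + 1) :=
  row_mx (const_mx (complex.Re z)) (const_mx (complex.Im z)).

Definition cline_point (v : 'rV[R]_(1 + 1)) : R[i]^o :=
  lsubmx v 0 0 +i* rsubmx v 0 0.

Lemma cline_coordK : cancel cline_coord cline_point.
Proof.
by case=> a b; rewrite /cline_point /cline_coord row_mxKl row_mxKr !mxE.
Qed.

Lemma cline_pointK : cancel cline_point cline_coord.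
Proof.
move=> v; rewrite /cline_point /cline_coord /= -[RHS]hsubmxK.
by congr row_mx; apply/rowP => i; rewrite !mxE !ord1.
Qed.

Lemma cline_nbhs (x : R[i]^o) (A : set R[i]^o) : nbhs x A <->
  exists2 e : R, 0 < e & forall z, `|complex.Re x - complex.Re z| < e ->
    `|complex.Im x - complex.Im z| < e -> A z.
Proof.
have ReImB (z w : R[i]) : (complex.Re (z - w) = complex.Re z - complex.Re w) *
                 (complex.Im (z - w) = complex.Im z - complex.Im w).
  by case: z w => [a b] [c d].
split=> [/nbhs_ballP[e /= e0 xA]|[e e0 xA]].
  move: e0 xA; rewrite ltcE /=; case: e => e i /= /andP[/eqP -> e0] xA.
  exists (e / 2); first by rewrite divr_gt0.
  move=> z rez imz; apply: xA; rewrite -ball_normE /= [x - z]complexE !ReImB.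
  apply: (le_lt_trans (ler_normD _ _)).
  have norm_real (r : R) : `|r%:C| = `|r|%:C.
    by rewrite normc_def /= expr0n addr0 sqrtr_sqr.
  have normi : `|'i : R[i]| = 1.
    by rewrite normc_def /= expr0n add0r expr1n sqrtr1.
  rewrite normrM normi mul1r !norm_real -rmorphD /= ltcR.
  by rewrite (splitr e) ltrD.
apply/nbhs_ballP; exists e%:C; first by rewrite /= ltcR.
move=> z; rewrite -ball_normE /= => xz; apply: xA.
  rewrite -ltcR; apply: le_lt_trans xz; rewrite -(ReImB x z).1.
  exact: normc_ge_Re.
rewrite -ltcR; apply: le_lt_trans xz; rewrite -(ReImB x z).2.
case: (x - z) => a b; rewrite normc_def /= lecR -sqrtr_sqr ler_wsqrtr //.
by rewrite lerDr sqr_ge0.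
Qed.

Lemma cline_coord_cts : continuous cline_coord.
Proof.
move=> x A /nbhs_ballP[e /= e0 xA]; apply/cline_nbhs; exists e => // z rez imz.
apply: xA; split=> // i j; rewrite !mxE.
by case: splitP => k _; rewrite !mxE -ball_normE.
Qed.

Lemma cline_point_cts : continuous cline_point.
Proof.
move=> v A /cline_nbhs[e e0 vA]; apply/nbhs_ballP; exists e => // w [_ vw].
by apply: vA; rewrite /= !mxE; move: (vw 0); rewrite -ball_normE; apply.
Qed.

Lemma cline_img : cline_coord @` setT = setT.
Proof.
by apply/seteqP; split=> // v _; exists (cline_point v) => //; exact: cline_pointK.
Qed.

Lemma cline_img_open : open (cline_coord @` setT).
Proof. by rewrite cline_img; exact: openT. Qed.

Definition cline_chart : chart R (R[i]^o : topologicalType) (1 + 1) :=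
  @Chart R _ _ setT cline_coord cline_point openT cline_img_open
    (fun z _ => cline_coordK z) (fun z _ => @cline_coord_cts z)
    (fun v _ => @cline_point_cts v).

Lemma cline_hausdorff : hausdorff_space (R[i]^o : topologicalType).
Proof. exact: norm_hausdorff. Qed.

Lemma cline_second_countable : @second_countable (R[i]^o : topologicalType).
Proof.
pose box (q : (rat * rat) * (rat * rat)) : set R[i]^o :=
  [set z | (ratr q.1.1 < complex.Re z < ratr q.1.2) &&
           (ratr q.2.1 < complex.Im z < ratr q.2.2)].
exists (range box).
  by apply: (sub_countable (card_image_le _ _)); exact: countableP.
split=> [_ [q _ <-]|x A /cline_nbhs[e e0 xA]].
  rewrite openE => z /= /andP[/andP[l1 l2] /andP[l3 l4]]; apply/cline_nbhs.
  pose m := Num.min (Num.min (complex.Re z - ratr q.1.1)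
                             (ratr q.1.2 - complex.Re z))
                    (Num.min (complex.Im z - ratr q.2.1)
                             (ratr q.2.2 - complex.Im z)).
  exists m; first by rewrite !lt_min !subr_gt0 l1 l2 l3 l4.
  move=> w /=; rewrite !lt_min !ltr_norml.
  move=> /andP[/andP[/andP[_ a1] /andP[a2 _]] _].
  move=> /andP[_ /andP[/andP[_ b1] /andP[b2 _]]].
  by rewrite /box /=; apply/andP; split; apply/andP; split; lra.
have near_rat (r : R) : exists q : rat * rat,
    [/\ ratr q.1 < r, r < ratr q.2, r - e < ratr q.1 & ratr q.2 < r + e].
  have [q1 /itvP q1P] : exists q, ratr q \in `]r - e, r[.
    by apply: rat_in_itvoo; rewrite ltrBlDr ltrDl.
  have [q2 /itvP q2P] : exists q, ratr q \in `]r, r + e[.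
    by apply: rat_in_itvoo; rewrite ltrDl.
  by exists (q1, q2); rewrite /= !q1P !q2P.
have [p [p1 p2 p3 p4]] := near_rat (complex.Re x).
have [q [q1 q2 q3 q4]] := near_rat (complex.Im x).
exists (box (p, q)).
  by split; [exists (p, q) | rewrite /box /= p1 p2 q1 q2].
move=> z /= /andP[/andP[z1 z2] /andP[z3 z4]].
by apply: xA; rewrite ltr_norml; apply/andP; split; lra.
Qed.

Lemma cline_cover (z : R[i]^o) :
  exists2 a, [set cline_chart] a & chart_dom a z.
Proof. by exists cline_chart. Qed.

Lemma cline_compat a b : [set cline_chart] a -> [set cline_chart] b ->
  holo (@Jmul R 1) (@Jmul R 1)
    (a @` (chart_dom a `&` chart_dom b)) (b \o chart_inv a).
Proof. by move=> -> ->; apply: holo_id; exact: cline_pointK. Qed.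

Definition cline_smooth : smoothManifold R (1 + 1) :=
  @SmoothManifold R _ (R[i]^o : topologicalType) [set cline_chart]
    cline_hausdorff cline_second_countable cline_cover
    (fun a b ha hb => proj1 (cline_compat ha hb)).

Definition cline : complexManifold R 1 :=
  @ComplexManifold R 1 cline_smooth cline_compat.

End ComplexLine.

Section Tangent.
Context {R : realType}.

Definition smooth_fun m (M : smoothManifold R m) (U : set M) (h : M -> R[i]) :=
  smooth_on (N := cline R) U h.

Definition holo_fun m (M : complexManifold R m) (U : set M) (h : M -> R[i]) :=
  holo_on (N := cline R) U h.

Definition smooth_at m (M : smoothManifold R m) (x : M) (h : M -> R[i]) : Prop :=
  exists U : set M, open_nbhs x U /\ smooth_fun U h.

(* Complexified tangent vectors at x are the C-linear derivations of the algebra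
   of germs at x of smooth complex valued functions.  They are represented by
   functionals on all functions M -> C; the clause [tan_supp] fixes the
   irrelevant values, so that equal vectors are equal functionals. *)
Definition vec m (M : smoothManifold R m) := (M -> R[i]) -> R[i].

Record ctangent m (M : smoothManifold R m) (x : M) (D : vec M) : Prop := {
  tan_supp : forall h, ~ smooth_at x h -> D h = 0;
  tan_germ : forall h k, smooth_at x h -> smooth_at x k ->
    (\forall y \near x, h y = k y) -> D h = D k;
  tan_linear : forall (c : R[i]) h k, smooth_at x h -> smooth_at x k ->
    D (fun y => c * h y + k y) = c * D h + D k;
  tan_leibniz : forall h k, smooth_at x h -> smooth_at x k ->
    D (fun y => h y * k y) = D h * k x + h x * D k
}.

(* Complex conjugation of C TM = C (x) TM. *)
Definition conjv m (M : smoothManifold R m) (D : vec M) : vec M :=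
  fun h => (D (fun y => (h y)^*))^*.

Definition real_tangent m (M : smoothManifold R m) (x : M) (D : vec M) : Prop :=
  ctangent x D /\ conjv D = D.

(* The differential at x of a map which is smooth near x. *)
Definition pushforward m n (M : smoothManifold R m) (N : smoothManifold R n)
    (f : M -> N) (x : M) (D : vec M) : vec N :=
  fun h => if `[< smooth_at (f x) h >] then D (h \o f) else 0.

Definition zerov m (M : smoothManifold R m) : vec M := fun=> 0.

Definition addv m (M : smoothManifold R m) (D E : vec M) : vec M :=
  fun h => D h + E h.

Definition lincomb m (M : smoothManifold R m) k (c : 'I_k -> R[i])
    (D : 'I_k -> vec M) : vec M := fun h => \sum_(i < k) c i * D i h.

Definition cspan m (M : smoothManifold R m) (A : set (vec M)) : set (vec M) :=
  [set D | exists k (c : 'I_k -> R[i]) (E : 'I_k -> vec M),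
     (forall i, A (E i)) /\ D = lincomb c E].

Definition smooth_vfield m (M : smoothManifold R m) (U : set M)
    (Z : M -> vec M) : Prop :=
  (forall x, U x -> ctangent x (Z x)) /\
  forall V h, open V -> V `<=` U -> smooth_fun V h ->
    smooth_fun V (fun y => Z y h).

Definition lie_bracket m (M : smoothManifold R m) (Z W : M -> vec M) :
    M -> vec M :=
  fun x h => if `[< smooth_at x h >]
             then Z x (fun y => W y h) - W x (fun y => Z y h) else 0.

(* E is a smooth complex subbundle of rank k of C TM: it has local smooth
   frames. *)
Definition smooth_subbundle m (M : smoothManifold R m) (k : nat)
    (E : M -> set (vec M)) : Prop :=
  forall x, exists (U : set M) (Z : 'I_k -> M -> vec M),
    [/\ open_nbhs x U,
        forall i, smooth_vfield U (Z i),
        forall y D, U y -> E y D <->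
          exists c : 'I_k -> R[i], D = lincomb c (fun i => Z i y) &
        forall y (c : 'I_k -> R[i]), U y ->
          lincomb c (fun i => Z i y) = @zerov _ M -> forall i, c i = 0].

Definition vsection m (M : smoothManifold R m) (E : M -> set (vec M))
    (U : set M) (Z : M -> vec M) : Prop :=
  smooth_vfield U Z /\ forall x, U x -> E x (Z x).

Record crManifold (n : nat) := CRManifold {
  cr_smooth :> smoothManifold R n;
  T10 : cr_smooth -> set (vec cr_smooth);
  cr_rank : nat;
  T10_subbundle : smooth_subbundle cr_rank T10;
  T10_conj : forall x D, T10 x D -> (@conjv _ cr_smooth @` T10 x) D ->
    D = @zerov _ cr_smooth;
  T10_involutive : forall U Z W, open U ->
    vsection T10 U Z -> vsection T10 U W -> vsection T10 U (lie_bracket Z W)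
}.

Definition T01 n (X : crManifold n) (x : X) : set (vec X) :=
  @conjv _ X @` T10 x.

(* The bundle of vectors of type (1,0) of a complex manifold: the derivations
   which vanish on antiholomorphic functions. *)
Definition cmfd_T10 n (Y : complexManifold R n) (y : Y) : set (vec Y) :=
  [set D | ctangent y D /\
     forall (V : set Y) h, open_nbhs y V -> holo_fun V h ->
       D (fun z => (h z)^*) = 0].

Definition preserves m n (M : smoothManifold R m) (N : smoothManifold R n)
    (E : M -> set (vec M)) (F : N -> set (vec N)) (U : set M) (f : M -> N) :=
  forall x D, U x -> E x D -> F (f x) (pushforward f x D).

Definition cr_map m n (X : crManifold m) (X' : crManifold n) (f : X -> X') :=
  smooth_on setT f /\ preserves (@T10 _ X) (@T10 _ X') setT f.

Definition cr_automorphism n (X : crManifold n) (f : X -> X) : Prop :=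
  cr_map f /\ exists f' : X -> X, [/\ cr_map f', cancel f f' & cancel f' f].

(* CR maps from an open subset of X to a complex manifold, regarded as the CR
   manifold with the bundle [cmfd_T10]. *)
Definition cr_to_complex_on m n (X : crManifold m) (Y : complexManifold R n)
    (U : set X) (f : X -> Y) : Prop :=
  smooth_on U f /\ preserves (@T10 _ X) (@cmfd_T10 _ Y) U f.

Definition cr_fun n (X : crManifold n) (U : set X) (h : X -> R[i]) : Prop :=
  cr_to_complex_on (Y := cline R) U h.

End Tangent.
Arguments crManifold R n : clear implicits.

Section LieGroups.
Context {R : realType}.

Record lieGroup (n : nat) := LieGroup {
  lie_mfd :> smoothManifold R n;
  lie_one : lie_mfd;
  lie_mul : lie_mfd -> lie_mfd -> lie_mfd;
  lie_inv : lie_mfd -> lie_mfd;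
  lie_mulA : associative lie_mul;
  lie_mul1 : left_id lie_one lie_mul;
  lie_mulV : left_inverse lie_one lie_inv lie_mul;
  lie_mul_smooth : smooth2 lie_mul;
  lie_inv_smooth : smooth_on setT lie_inv
}.

Record complexLieGroup (n : nat) := ComplexLieGroup {
  clie_lie :> lieGroup (n + n);
  clie_atlas : holomorphic_atlas clie_lie;
  clie_mfd := ComplexManifold clie_atlas;
  clie_mul_holo : @holo2 R n n n clie_mfd clie_mfd clie_mfd
    (@lie_mul _ clie_lie);
  clie_inv_holo : @holo_on R n n clie_mfd clie_mfd setT (@lie_inv _ clie_lie)
}.

Definition lie_hom m n (G : lieGroup m) (H : lieGroup n) (phi : G -> H) :=
  smooth_on setT phi /\ {morph phi : g h / lie_mul g h}.

Definition holo_lie_hom m n (G : complexLieGroup m) (H : complexLieGroup n)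
    (phi : G -> H) : Prop :=
  @holo_on R m n (clie_mfd G) (clie_mfd H) setT phi /\
  {morph phi : g h / lie_mul g h}.

Definition universal_complexification m n (G : lieGroup m)
    (GC : complexLieGroup n) (iota : G -> GC) : Prop :=
  lie_hom iota /\
  forall k (H : complexLieGroup k) (phi : G -> H), lie_hom phi ->
    exists! psi : GC -> H, holo_lie_hom psi /\ phi = psi \o iota.

Definition closed_in_complexification m (G : lieGroup m) : Prop :=
  exists n (GC : complexLieGroup n) (iota : G -> GC),
    [/\ universal_complexification iota, injective iota & closed (range iota)].

Record lieAction m n (G : lieGroup m) (X : smoothManifold R n) := LieAction {
  lie_act :> G -> X -> X;
  lie_act1 : forall x, lie_act (lie_one G) x = x;
  lie_actM : forall g h x, lie_act (lie_mul g h) x = lie_act g (lie_act h x);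
  lie_act_smooth : smooth2 lie_act
}.

Definition cr_action m n (G : lieGroup m) (X : crManifold R n)
    (A : lieAction G X) : Prop := forall g, cr_automorphism (A g).

Definition proper_action m n (G : lieGroup m) (X : smoothManifold R n)
    (A : lieAction G X) : Prop :=
  forall K : set (X * X)%type, compact K ->
    compact [set gx : (G * X)%type | K (A gx.1 gx.2, gx.2)].

(* The value at x of the fundamental vector field of [xi], an element of the Lie
   algebra T_1 G. *)
Definition fundamental m n (G : lieGroup m) (X : smoothManifold R n)
    (A : lieAction G X) (xi : vec G) (x : X) : vec X :=
  pushforward (fun g => A g x) (lie_one G) xi.

(* Fundamental vector fields are linear in xi, so that this set is already a
   real vector space. *)
Definition lie_directions m n (G : lieGroup m) (X : smoothManifold R n)
    (A : lieAction G X) (x : X) : set (vec X) :=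
  [set fundamental A xi x | xi in real_tangent (lie_one G)].

Definition transversal_action m n (G : lieGroup m) (X : crManifold R n)
    (A : lieAction G X) : Prop :=
  forall (x : X) (D : vec X), ctangent x D ->
    exists! t : vec X * vec X * vec X,
      [/\ cspan (lie_directions A x) t.1.1, T10 x t.1.2, T01 x t.2 &
          D = addv (addv t.1.1 t.1.2) t.2].

End LieGroups.
Arguments lieGroup R n : clear implicits.
Arguments complexLieGroup R n : clear implicits.

Section Quotient.
Context {R : realType}.

(* [fs_sheaf U h] means that (the restriction to the open set U of) h is a
   section over U of the structure sheaf, a sheaf of complex valued functions. *)
Record functionSpace := FunctionSpace {
  fs_top :> topologicalType;
  fs_sheaf : set fs_top -> set (fs_top -> R[i])
}.

(* Morphisms of spaces with sheaves of functions; between reduced complex spaces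
   these are the holomorphic maps. *)
Definition holomorphic_map (S T : functionSpace) (f : S -> T) : Prop :=
  continuous f /\
  forall (V : set T) (h : T -> R[i]), open V -> fs_sheaf V h ->
    fs_sheaf (f @^-1` V) (h \o f).

Definition complex_space_of n (Y : complexManifold R n) : functionSpace :=
  @FunctionSpace Y (fun V h => holo_fun V h).

Section Orbits.
Context (m n : nat) (G : lieGroup R m) (X : crManifold R n) (A : lieAction G X).

Definition same_orbit (x y : X) : bool := `[< exists g, y = A g x >].

Lemma same_orbit_equiv : equiv_class_of same_orbit.
Proof.
split=> [x|x y|y x z].
- by apply/asboolP; exists (lie_one G); rewrite lie_act1.
- apply/asboolP/asboolP => -[g ->]; exists (lie_inv g);
    by rewrite -lie_actM lie_mulV lie_act1.
- move=> /asboolP[g ->] /asboolP[h ->]; apply/asboolP.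
  by exists (lie_mul h g); rewrite lie_actM.
Qed.

Canonical same_orbit_rel := EquivRelPack same_orbit_equiv.

Definition orbit_space : topologicalType :=
  quotient_topology {eq_quot same_orbit_rel}.

Definition orbit_proj : X -> orbit_space := \pi_({eq_quot same_orbit_rel}).

(* h |-> h \o orbit_proj identifies the functions on an open set U of X/G with
   the G-invariant functions on its preimage; sections over U are those h which
   correspond to CR functions. *)
Definition quotient_space : functionSpace :=
  @FunctionSpace orbit_space
    (fun U h => cr_fun (orbit_proj @^-1` U) (h \o orbit_proj)).

End Orbits.
End Quotient.

(* Main.v *)
(** As f is constant on orbits it descends to a unique map fbar, which is
    continuous for the quotient topology.  For h holomorphic on V, the function
    h o fbar is a section of the structure sheaf of X/G because h o f is CR:
    a vector of type (1,0) is pushed forward by f to one which annihilates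
    conjugates of holomorphic functions, in particular the conjugates of k o h
    for k holomorphic on an open subset of C.  The analytic input is that smooth
    and holomorphic maps compose, by the chain rule in charts. *)
From HB Require Import structures.
Require Import Defs.
From mathcomp Require Import all_boot all_order all_algebra.
From mathcomp Require Import all_classical all_reals all_analysis.
From mathcomp Require Import complex.
Import Order.TTheory GRing.Theory Num.Theory numFieldNormedType.Exports.
Local Open Scope classical_set_scope.
Local Open Scope ring_scope.
Local Open Scope complex_scope.
Local Open Scope quotient_scope.
Set Implicit Arguments.
Unset Strict Implicit.
Unset Printing Implicit Defensive.

(** * Calculus of [Ck] and [holo] on normed spaces *)

Section SmoothCalculus.
Context {R : realType}.
Implicit Types V W : normedModType R.

(** The first-order expansion of [f] at [x] involves only the germ of [f], so it is also an
    expansion of [g]; uniqueness of the differential does the rest. *)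
Lemma near_eq_differentiable V W (f g : V -> W) x :
  (\forall y \near x, f y = g y) -> differentiable f x ->
  differentiable g x /\ 'd g x = 'd f x :> (V -> W).
Proof.
move=> fg df.
have gE : g \o shift x = cst (g x) + 'd f x +o_ 0 id.
  have := diff_locally df; rewrite eqaddoP => fo; apply/eqaddoP => e e0.
  have fgx : \forall h \near 0, f (h + x) = g (h + x).
    have shx : (h + x) @[h --> (0 : V)] --> x.
      by rewrite -[X in _ --> X]add0r; apply: cvgD; [exact: cvg_id|exact: cvg_cst].
    by move: (shx _ fg).
  near=> h; have <- : (f \o shift x - (cst (f x) + 'd f x)) h =
                      (g \o shift x - (cst (g x) + 'd f x)) h.
    rewrite !fctE /= (nbhs_singleton fg); congr (_ - _).
    by near: h.
  by near: h; exact: fo.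
have dgE : 'd g x = 'd f x :> (V -> W).
  by apply: diff_unique => //; exact: diff_continuous.
split=> //; apply/diff_locallyP; rewrite dgE; split=> //.
exact: diff_continuous.
Unshelve. all: by end_near. Qed.

Lemma Ck_subset V W k (U U' : set V) (f : V -> W) :
  U `<=` U' -> Ck k U' f -> Ck k U f.
Proof.
move=> sU; elim: k f => [|k IH] f /=; first by move=> cf x /sU; exact: cf.
move=> [df cf].
by split=> [x /sU|v]; [exact: df | exact: IH].
Qed.

(** [Ck] tests only points of [U], with differentials taken in the ambient space, so it can be
    checked one point at a time. *)
Lemma Ck_pointwise V W k (U : set V) (f : V -> W) :
  (forall x, U x -> Ck k [set x] f) -> Ck k U f.
Proof.
elim: k f => [|k IH] f /= cf; first by move=> x Ux; exact: (cf x Ux x).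
by split=> [x Ux|v]; [exact: (cf x Ux).1 | apply: IH => x Ux; exact: (cf x Ux).2].
Qed.

(** Openness of [U] turns equality on [U] into equality of germs, hence of differentials, and the
    induction on [k] continues with the directional derivatives. *)
Lemma eq_Ck V W k (U : set V) (f g : V -> W) :
  open U -> {in U, f =1 g} -> Ck k U f -> Ck k U g.
Proof.
move=> oU.
have nfg (h h' : V -> W) (x : V) : {in U, h =1 h'} -> U x ->
    \forall y \near x, h y = h' y.
  move=> hh' Ux; have : nbhs x U by exact: open_nbhs_nbhs.
  by apply: filterS => y Uy; apply: hh'; rewrite inE.
elim: k f g => [|k IH] f g fg /=.
  move=> cf x Ux; change (g @ x --> g x); rewrite -(fg x) ?inE//.
  by apply: cvg_trans (cf x Ux); apply: near_eq_cvg; exact: nfg.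
move=> [df cf].
have dfg x (Ux : U x) := near_eq_differentiable (nfg _ _ _ fg Ux) (df x Ux).
split=> [x Ux|v]; first exact: (dfg x Ux).1.
by apply: IH (cf v) => x; rewrite inE => Ux; rewrite (dfg x Ux).2.
Qed.

Lemma CkW V W k (U : set V) (f : V -> W) : Ck k.+1 U f -> Ck k U f.
Proof.
elim: k f => [|k IH] f [df cf]; last by split=> // v; exact: IH.
by move=> x Ux; apply: differentiable_continuous; exact: df.
Qed.

Lemma CkD V W k (U : set V) (f g : V -> W) : open U ->
  Ck k U f -> Ck k U g -> Ck k U (f + g).
Proof.
move=> oU; elim: k f g => [|k IH] f g /=.
  by move=> cf cg x Ux; apply: continuousD; [exact: cf|exact: cg].
move=> [df cf] [dg cg].
split=> [x Ux|v]; first by apply: differentiableD; [exact: df|exact: dg].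
apply: eq_Ck (IH _ _ (cf v) (cg v)) => // x; rewrite inE => Ux.
have E := diffD (df x Ux) (dg x Ux).
by rewrite E.
Qed.

Lemma Ck_sum V W k (U : set V) (I : Type) (r : seq I) (f : I -> V -> W) :
  open U -> (forall i, Ck k U (f i)) -> Ck k U (fun x => \sum_(i <- r) f i x).
Proof.
move=> oU cf; elim: r => [|i r IH].
  by rewrite (_ : (fun x => _) = fun=> 0); [exact: Ck_cst|
    apply/funext => x; rewrite big_nil].
rewrite (_ : (fun x => _) = f i + fun x => \sum_(j <- r) f j x); first exact: CkD.
by apply/funext => x; rewrite big_cons.
Qed.

Lemma Ck_linear V W W' k (U : set V) (L : {linear W -> W'}) (f : V -> W) :
  continuous L -> open U -> Ck k U f -> Ck k U (L \o f).
Proof.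
move=> cL oU; elim: k f => [|k IH] f /=.
  by move=> cf x Ux; apply: continuous_comp; [exact: cf|exact: cL].
move=> [df cf].
have dL y : differentiable L y by exact: linear_differentiable.
split=> [x Ux|v]; first by apply: differentiable_comp => //; exact: df.
apply: eq_Ck (IH _ (cf v)) => // x; rewrite inE => Ux.
by rewrite diff_comp//=; [rewrite diff_lin|exact: df].
Qed.

Lemma Ck_coord V k m n (U : set V) (f : V -> 'M[R]_(m, n)) i j :
  open U -> Ck k U f -> Ck k U (fun x => f x i j).
Proof.
move=> oU cf.
have lin : linear (fun N : 'M[R]_(m, n) => N i j) by move=> ? ? ?; rewrite !mxE.
pose linM := GRing.isLinear.Build _ _ _ _ _ lin.
pose L : {linear 'M[R]_(m, n) -> R} := HB.pack (fun N : 'M[R]_(m, n) => N i j) linM.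
by apply: (@Ck_linear _ _ _ k U L f) => //; exact: coord_continuous.
Qed.

Lemma Ck_scalel V W k (U : set V) (f : V -> R) (w : W) :
  open U -> Ck k U f -> Ck k U (fun x => f x *: w).
Proof.
move=> oU cf.
have lin : linear (fun a : R => a *: w) by move=> a u v; rewrite scalerDl scalerA.
pose linM := GRing.isLinear.Build _ _ _ _ _ lin.
pose L : {linear R -> W} := HB.pack (fun a : R => a *: w) linM.
by apply: (@Ck_linear _ _ _ k U L f) => //; exact: scalel_continuous.
Qed.

Lemma CkM V k (U : set V) (f g : V -> R) : open U ->
  Ck k U f -> Ck k U g -> Ck k U (f * g).
Proof.
move=> oU; elim: k f g => [|k IH] f g cf cg.
  by move=> x Ux; apply: continuousM; [exact: cf|exact: cg].
have [[df cf'] [dg cg']] := (cf, cg).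
split=> [x Ux|v]; first by apply: differentiableM; [exact: df|exact: dg].
have cD : Ck k U (f * (fun x => 'd g x v) + g * (fun x => 'd f x v)).
  apply: CkD => //.
    by apply: IH; [apply: CkW; exact: cf|exact: cg'].
  by apply: IH; [apply: CkW; exact: cg|exact: cf'].
apply: eq_Ck cD => // x; rewrite inE => Ux.
have E := diffM (df x Ux) (dg x Ux).
by rewrite E.
Qed.

Lemma Ck_row V k n (U : set V) (f : V -> 'rV[R]_n) : open U ->
  (forall j, Ck k U (fun x => f x 0 j)) -> Ck k U f.
Proof.
move=> oU cf; apply: (@eq_Ck _ _ _ _ (fun x => \sum_j f x 0 j *: 'e_j)) => //.
  by move=> x _; rewrite -row_sum_delta.
by apply: Ck_sum => // j; exact: Ck_scalel.
Qed.

Lemma Ck_comp V k p q (U : set V) (O : set 'rV[R]_p) (f : V -> 'rV[R]_p)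
    (g : 'rV[R]_p -> 'rV[R]_q) : open U -> (forall x, U x -> O (f x)) ->
  Ck k U f -> Ck k O g -> Ck k U (g \o f).
Proof.
move=> oU fUO cf; elim: k g cf => [|k IH] g cf cg.
  by move=> x Ux; apply: continuous_comp; [exact: cf|apply: cg; exact: fUO].
have [[df cf'] [dg cg']] := (cf, cg).
split=> [x Ux|v].
  by apply: differentiable_comp; [exact: df|apply: dg; exact: fUO].
(* The chain rule gives ['d g (f x) ('d f x v)], where [x] occurs twice. Expanding ['d f x v] in the
   standard basis yields a sum of products of a coordinate of a derivative of [f] with some
   ['d g (f x) 'e_i]. *)
apply: (@eq_Ck _ _ _ _
  (fun x => \sum_i ('d f x v) 0 i *: 'd g (f x) 'e_i)) => //.
  move=> x; rewrite inE => Ux; rewrite (diff_comp (df x Ux) (dg _ (fUO _ Ux)))/=.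
  rewrite [in RHS](row_sum_delta ('d f x v)) linear_sum.
  by apply: eq_bigr => i _; rewrite linearZ.
apply: Ck_sum => // i; apply: Ck_row => // j.
rewrite (_ : (fun x => _) =
    (fun x => 'd f x v 0 i) * (fun x => ('d g (f x) 'e_i) 0 j)); last first.
  by apply/funext => x; rewrite mxE.
apply: CkM => //; first exact: (Ck_coord 0 i oU (cf' v)).
(* The second factor is again a composite with [f], with outer map ['d g _ 'e_i] of order [k], so
   the induction hypothesis applies. *)
have cg'f := IH (fun y => 'd g y 'e_i) (CkW cf) (cg' 'e_i).
exact: (Ck_coord 0 j oU cg'f).
Qed.

Lemma holo_subset V W (JV : V -> V) (JW : W -> W)
    (U U' : set V) (f : V -> W) :
  U `<=` U' -> holo JV JW U' f -> holo JV JW U f.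
Proof.
move=> sU [cf df]; split=> [k|x v /sU]; first exact: Ck_subset (cf k).
exact: df.
Qed.

(** Both clauses of [holo] are conditions at points; this lets the set [O], and so a chart, be
    chosen separately around each point. *)
Lemma holo_pointwise V W (JV : V -> V) (JW : W -> W) (U : set V) (f : V -> W) :
  (forall x, U x -> exists2 O : set V, O x & holo JV JW O f) -> holo JV JW U f.
Proof.
move=> hf; split=> [k|x v /hf[N Nx [_ dN] ] ]; last exact: dN.
apply: Ck_pointwise => x /hf[N Nx [cf _] ].
by apply: Ck_subset (cf k) => _ ->.
Qed.

Lemma eq_holo V W (JV : V -> V) (JW : W -> W) (U : set V) (f g : V -> W) :
  open U -> {in U, f =1 g} -> holo JV JW U f -> holo JV JW U g.
Proof.
move=> oU fg [cf df]; split=> [k|x v Ux]; first exact: eq_Ck (cf k).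
have nfg : \forall y \near x, f y = g y.
  have : nbhs x U by exact: open_nbhs_nbhs.
  by apply: filterS => y Uy; apply: fg; rewrite inE.
by rewrite (near_eq_differentiable nfg ((cf 1%N).1 x Ux)).2 df.
Qed.

Lemma holo_comp V p q (JV : V -> V) (Jp : 'rV[R]_p -> 'rV[R]_p)
    (Jq : 'rV[R]_q -> 'rV[R]_q) (U : set V) (O : set 'rV[R]_p)
    (f : V -> 'rV[R]_p) (g : 'rV[R]_p -> 'rV[R]_q) :
  open U -> (forall x, U x -> O (f x)) ->
  holo JV Jp U f -> holo Jp Jq O g -> holo JV Jq U (g \o f).
Proof.
move=> oU fUO [cf df] [cg dg]; split=> [k|x v Ux]; first exact: Ck_comp (cf k) (cg k).
have Df : differentiable f x by exact: (cf 1%N).1.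
have Dg : differentiable g (f x) by apply: (cg 1%N).1; exact: fUO.
by rewrite (diff_comp Df Dg)/= df// dg//; exact: fUO.
Qed.

End SmoothCalculus.

Lemma open_setI_preimage (S T : topologicalType) (f : S -> T) (U : set S)
    (V : set T) : open U -> (forall x, U x -> {for x, continuous f}) ->
  open V -> open (U `&` f @^-1` V).
Proof.
move=> oU cf oV; rewrite openE => x [Ux Vfx]; apply: filterI.
  exact: open_nbhs_nbhs.
by apply: (cf x Ux); exact: open_nbhs_nbhs.
Qed.

(** * Smooth and holomorphic maps between manifolds, in charts *)

Section Manifolds.
Context {R : realType}.

Lemma chart_image_open (T : topologicalType) n (a : chart R T n) (U : set T) :
  open U -> U `<=` chart_dom a -> open (a @` U).
Proof.
move=> oU Ua.
rewrite (_ : a @` U = (a @` chart_dom a) `&` chart_inv a @^-1` U).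
  apply: open_setI_preimage => //; first exact: chart_img_open.
  by move=> v; exact: chart_inv_cts.
apply/seteqP; split=> [_ [x Ux <-]|_ [[x ax <-] ] /=].
  by split; [exists x => //; exact: Ua|rewrite /= chartK//; exact: Ua].
by rewrite chartK// => Ux; exists x.
Qed.

Lemma chart_image_openI (T : topologicalType) n (a : chart R T n) (U : set T) :
  open U -> open (a @` (U `&` chart_dom a)).
Proof.
move=> oU; apply: chart_image_open => [|x []//].
by apply: openI => //; exact: chart_dom_open.
Qed.

(* Smoothness is complex linearity for the zero structures, so that smooth and
   holomorphic maps can be treated together. *)
Lemma Cinfty_holo (V W : normedModType R) (U : set V) (f : V -> W) :
  Cinfty U f <-> holo (fun=> 0) (fun=> 0) U f.
Proof. by split=> [cf|[]//]; split=> // x v _; rewrite linear0. Qed.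

(** Near a given point, the coordinate expression of [g \o f] factors through a chart [b] of [N]
    around the image point, and [holo_comp] applies. Arbitrary [JM], [JN], [JP] cover the smooth and
    the holomorphic case at once. *)
Lemma coord_comp m n p (M : smoothManifold R m) (N : smoothManifold R n)
    (P : smoothManifold R p) (JM : 'rV[R]_m -> 'rV[R]_m)
    (JN : 'rV[R]_n -> 'rV[R]_n) (JP : 'rV[R]_p -> 'rV[R]_p)
    (U : set M) (V : set N) (f : M -> N) (g : N -> P) :
  open U -> open V -> U `<=` f @^-1` V ->
  (forall x, U x -> {for x, continuous f}) ->
  (forall y, V y -> {for y, continuous g}) ->
  (forall a b, atlas a -> atlas b -> holo JM JN
     (a @` (U `&` chart_dom a `&` f @^-1` chart_dom b)) (b \o f \o chart_inv a)) ->
  (forall b c, atlas b -> atlas c -> holo JN JP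
     (b @` (V `&` chart_dom b `&` g @^-1` chart_dom c)) (c \o g \o chart_inv b)) ->
  forall a c, atlas a -> atlas c -> holo JM JP
     (a @` (U `&` chart_dom a `&` (g \o f) @^-1` chart_dom c))
     (c \o (g \o f) \o chart_inv a).
Proof.
move=> oU oV UV cf cg hf hg a c ha hc.
apply: holo_pointwise => _ [x [[Ux ax] cx] <-].
have [b hb bx] := atlas_cover (f x).
pose Q := V `&` g @^-1` chart_dom c `&` chart_dom b.
have oQ : open Q.
  by apply: openI; [apply: open_setI_preimage => //|]; exact: chart_dom_open.
(* On [O] the charts [a], [b] and [c] are all usable along [x], [f x], [g (f x)], so [chart_inv b]
   cancels [b] in the factorisation. *)
pose O := U `&` f @^-1` Q `&` chart_dom a.
have oO : open O.
  by apply: openI; [exact: open_setI_preimage|exact: chart_dom_open].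
have oaO : open (a @` O) by apply: chart_image_open => // y [].
exists (a @` O).
  by exists x => //; split=> //; split=> //; split=> //; split=> //; exact: UV.
apply: (@eq_holo _ _ _ _ _ _ ((c \o g \o chart_inv b) \o (b \o f \o chart_inv a))) => //.
  move=> v; rewrite inE => -[y [[Uy [_ by_] ] ay] <-] /=.
  by rewrite !chartK.
apply: (@holo_comp _ _ _ _ _ JN _ _
  (b @` (V `&` chart_dom b `&` g @^-1` chart_dom c))) => //.
- move=> _ [y [[Uy [[Vy cy] by_] ] ay] <-] /=; rewrite chartK//.
  by exists (f y).
- apply: holo_subset (hf a b ha hb) => _ [y [[Uy [_ by_] ] ay] <-].
  by exists y.
- exact: hg.
Qed.

Lemma smooth_on_comp m n p (M : smoothManifold R m) (N : smoothManifold R n)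
    (P : smoothManifold R p) (U : set M) (V : set N) (f : M -> N) (g : N -> P) :
  open U -> open V -> U `<=` f @^-1` V ->
  smooth_on U f -> smooth_on V g -> smooth_on U (g \o f).
Proof.
move=> oU oV UV [cf sf] [cg sg]; split=> [x Ux|a c ha hc].
  by apply: continuous_comp; [exact: cf|apply: cg; exact: UV].
apply/Cinfty_holo; move: a c ha hc.
apply: (@coord_comp _ _ _ _ _ _ _ (fun=> 0) _ U V) => // a b ha hb; apply/Cinfty_holo.
  exact: sf.
exact: sg.
Qed.

Lemma holo_on_comp m n p (M : complexManifold R m) (N : complexManifold R n)
    (P : complexManifold R p) (U : set M) (V : set N) (f : M -> N) (g : N -> P) :
  open U -> open V -> U `<=` f @^-1` V ->
  holo_on U f -> holo_on V g -> holo_on U (g \o f).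
Proof.
move=> oU oV UV [cf sf] [cg sg]; split=> [x Ux|].
  by apply: continuous_comp; [exact: cf|apply: cg; exact: UV].
exact: (@coord_comp _ _ _ _ _ _ _ (@Jmul R n) _ U V).
Qed.

Lemma smooth_on_subset m n (M : smoothManifold R m) (N : smoothManifold R n)
    (U U' : set M) (f : M -> N) :
  U `<=` U' -> smooth_on U' f -> smooth_on U f.
Proof.
move=> sU [cf sf]; split=> [x /sU|a b ha hb k]; first exact: cf.
by apply: Ck_subset (sf a b ha hb k) => _ [x [[/sU Ux ax] bx] <-]; exists x.
Qed.

Lemma holo_on_subset m n (M : complexManifold R m) (N : complexManifold R n)
    (U U' : set M) (f : M -> N) :
  U `<=` U' -> holo_on U' f -> holo_on U f.
Proof.
move=> sU [cf sf]; split=> [x /sU|a b ha hb]; first exact: cf.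
by apply: holo_subset (sf a b ha hb) => _ [x [[/sU Ux ax] bx] <-]; exists x.
Qed.

Lemma holo_on_smooth m n (M : complexManifold R m) (N : complexManifold R n)
    (U : set M) (f : M -> N) : holo_on U f -> smooth_on U f.
Proof. by move=> [cf hf]; split=> // a b ha hb; exact: (hf a b ha hb).1. Qed.

End Manifolds.

(** * The algebra of smooth complex valued functions *)

Section SmoothFunctions.
Context {R : realType}.
Variables (m : nat) (M : smoothManifold R m).
Implicit Types (U : set M) (h k : M -> R[i]).

(** [cline] has a single chart, defined everywhere, whose two coordinates are the real and imaginary
    parts. Sums and products thus reduce to the real calculus. *)
Lemma smooth_fun_ReIm U h : open U ->
  smooth_fun U h <-> (forall x, U x -> {for x, continuous (h : M -> cline R)}) /\
    forall a, atlas (s := M) a ->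
      Cinfty (a @` (U `&` chart_dom a)) (fun v => complex.Re (h (chart_inv a v))) /\
      Cinfty (a @` (U `&` chart_dom a)) (fun v => complex.Im (h (chart_inv a v))).
Proof.
move=> oU; have oUa (a : chart R M m) := chart_image_openI (a := a) oU.
split=> [[ch sh]|[ch sh]]; split=> // a.
  move=> ha; have := sh a _ ha (erefl (cline_chart R)).
  rewrite /= preimage_setT setIT => sah.
  split=> k; [have := Ck_coord 0 (lshift 1 0) (oUa a) (sah k)
             |have := Ck_coord 0 (rshift 1 0) (oUa a) (sah k)];
  by apply: eq_Ck => // v _; rewrite /= /cline_coord ?row_mxEl ?row_mxEr mxE.
move=> b ha ->; rewrite /= preimage_setT setIT => k.
have [sre sim] := sh a ha.
apply: Ck_row => // j; case: (split_ordP j) => i ->.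
  by apply: eq_Ck (sre k) => // v _; rewrite /= /cline_coord row_mxEl mxE.
by apply: eq_Ck (sim k) => // v _; rewrite /= /cline_coord row_mxEr mxE.
Qed.

Lemma smooth_fun_cst U (c : R[i]) : open U -> smooth_fun U (fun=> c).
Proof.
move=> oU; apply/(smooth_fun_ReIm _ oU); split=> [x _|a ha].
  exact: cst_continuous.
by split=> k; exact: Ck_cst.
Qed.

Lemma smooth_funD U h k : open U -> smooth_fun U h -> smooth_fun U k ->
  smooth_fun U (fun x => h x + k x).
Proof.
move=> oU /(smooth_fun_ReIm _ oU)[ch sh] /(smooth_fun_ReIm _ oU)[ck sk].
apply/(smooth_fun_ReIm _ oU); split=> [x Ux|a ha].
  exact: (@continuousD _ _ _ (h : M -> R[i]^o) k x (ch x Ux) (ck x Ux)).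
have oUa := chart_image_openI (a := a) oU.
have [[hre him] [kre kim]] := (sh a ha, sk a ha).
split=> j.
  apply: eq_Ck (CkD oUa (hre j) (kre j)) => // v _.
  by rewrite /= !fctE /= raddfD.
apply: eq_Ck (CkD oUa (him j) (kim j)) => // v _.
by rewrite /= !fctE /= raddfD.
Qed.

Lemma smooth_funM U h k : open U -> smooth_fun U h -> smooth_fun U k ->
  smooth_fun U (fun x => h x * k x).
Proof.
move=> oU /(smooth_fun_ReIm _ oU)[ch sh] /(smooth_fun_ReIm _ oU)[ck sk].
apply/(smooth_fun_ReIm _ oU); split=> [x Ux|a ha].
  exact: (@continuousM _ _ (h : M -> R[i]) k x (ch x Ux) (ck x Ux)).
have oUa := chart_image_openI (a := a) oU.
have [[hre him] [kre kim]] := (sh a ha, sk a ha).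
split=> j.
  (* The real part of a product is [Re h * Re k - Im h * Im k]; the minus sign is a product with the
     constant [-1]. *)
  apply: eq_Ck (CkD oUa (CkM oUa (hre j) (kre j))
    (CkM oUa (Ck_cst _ (a @` (U `&` chart_dom a)) (-1 : R))
      (CkM oUa (him j) (kim j)))) => // v _.
  by rewrite !fctE /= mulN1r; case: (h _) (k _) => [? ?] [].
apply: eq_Ck (CkD oUa (CkM oUa (hre j) (kim j)) (CkM oUa (him j) (kre j))) => // v _.
by rewrite !fctE /=; case: (h _) (k _) => [? ?] [].
Qed.

Lemma smooth_at_lin x (c : R[i]) h k : smooth_at x h -> smooth_at x k ->
  smooth_at x (fun y => c * h y + k y).
Proof.
move=> [U [[oU Ux] sh]] [V [[oV Vx] sk]]; have oUV := openI oU oV.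
exists (U `&` V); split=> //; apply: smooth_funD => //.
  apply: smooth_funM => //; first exact: smooth_fun_cst.
  by apply: smooth_on_subset sh; exact: subIsetl.
by apply: smooth_on_subset sk; exact: subIsetr.
Qed.

Lemma smooth_atM x h k : smooth_at x h -> smooth_at x k ->
  smooth_at x (fun y => h y * k y).
Proof.
move=> [U [[oU Ux] sh]] [V [[oV Vx] sk]]; have oUV := openI oU oV.
exists (U `&` V); split=> //; apply: smooth_funM => //.
  by apply: smooth_on_subset sh; exact: subIsetl.
by apply: smooth_on_subset sk; exact: subIsetr.
Qed.

End SmoothFunctions.

(** * Pushforward of complex tangent vectors and vectors of type (1,0) *)

Section Pushforward.
Context {R : realType}.

Lemma smooth_at_comp m n (M : smoothManifold R m) (N : smoothManifold R n)
    (U : set M) (F : M -> N) x (h : N -> R[i]) :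
  open U -> U x -> smooth_on U F -> smooth_at (F x) h -> smooth_at x (h \o F).
Proof.
move=> oU Ux sF [V [[oV VFx] sh]]; exists (U `&` F @^-1` V).
have oUV := open_setI_preimage oU sF.1 oV.
have UVF : U `&` F @^-1` V `<=` F @^-1` V by exact: subIsetr.
have sF' : smooth_on (U `&` F @^-1` V) F.
  by apply: smooth_on_subset sF; exact: subIsetl.
by split; [|exact: (smooth_on_comp oUV oV UVF sF' sh)].
Qed.

(** The guard in [pushforward] yields [tan_supp]; on smooth germs each axiom is that of [D] for the
    functions pulled back along [F]. *)
Lemma pushforward_ctangent m n (M : smoothManifold R m) (N : smoothManifold R n)
    (U : set M) (F : M -> N) x (D : vec M) :
  open U -> U x -> smooth_on U F -> ctangent x D ->
  ctangent (F x) (Defs.pushforward F x D).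
Proof.
move=> oU Ux sF [Dsupp Dgerm Dlin Dleib].
have sc h : smooth_at (F x) h -> smooth_at x (h \o F) := smooth_at_comp oU Ux sF.
split=> [h nh|h k sh sk hk|c h k sh sk|h k sh sk]; rewrite /Defs.pushforward.
- by case: asboolP.
- rewrite !asboolT//; apply: Dgerm; [exact: sc|exact: sc|].
  exact: (sF.1 x Ux _ hk).
- rewrite !asboolT//; last exact: smooth_at_lin.
  by apply: (Dlin c (h \o F) (k \o F)); exact: sc.
- rewrite !asboolT//; last exact: smooth_atM.
  by apply: (Dleib (h \o F) (k \o F)); exact: sc.
Qed.

(** If [h] is smooth at [g (f x)], then [h \o g] is smooth at [f x], so both guards open; otherwise
    both sides are 0. *)
Lemma pushforward_comp m n p (M : smoothManifold R m) (N : smoothManifold R n)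
    (P : smoothManifold R p) (V : set N) (f : M -> N) (g : N -> P) x (D : vec M) :
  open V -> V (f x) -> smooth_on V g ->
  Defs.pushforward g (f x) (Defs.pushforward f x D) = Defs.pushforward (g \o f) x D.
Proof.
move=> oV Vfx sg; apply/funext => h; rewrite /Defs.pushforward /=.
by case: asboolP => // sh; rewrite asboolT//; exact: smooth_at_comp sg sh.
Qed.

Lemma holo_comp_cr m n (X : crManifold R n) (Y : complexManifold R m)
    (U : set X) (V : set Y) (f : X -> Y) (h : Y -> R[i]) :
  open U -> open V -> U `<=` f @^-1` V ->
  cr_to_complex_on U f -> holo_fun V h -> cr_fun U (h \o f).
Proof.
move=> oU oV UV [sf pf] hh.
have sh : smooth_fun V h := holo_on_smooth hh.
have shf : smooth_fun U (h \o f) := smooth_on_comp oU oV UV sf sh.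
split=> // x D Ux Dx; have [Dtan Dhol] := pf x D Ux Dx.
split.
  rewrite -(pushforward_comp _ oV (UV x Ux) sh).
  exact: (pushforward_ctangent oV (UV x Ux) sh Dtan).
(* If the conjugate of [k] is not smooth at [h (f x)], the value is 0 by default. Otherwise [k \o h]
   is holomorphic near [f x], and [Dhol] says that the pushed vector kills its conjugate. *)
move=> W k [oW Whfx] hk; rewrite /Defs.pushforward; case: asboolP => // sk.
have oVW : open (V `&` h @^-1` W) by exact: open_setI_preimage hh.1 _.
have hkh : holo_fun (V `&` h @^-1` W) (k \o h).
  have VW : V `&` h @^-1` W `<=` h @^-1` W by exact: subIsetr.
  have hh' : holo_fun (V `&` h @^-1` W) h.
    by apply: holo_on_subset hh; exact: subIsetl.
  exact: (@holo_on_comp R m 1 1 Y (cline R) (cline R) _ W h k oVW oW VW hh' hk).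
(* This opens the guard of [pushforward f x D], so that [Dhol] speaks of the value of [D] itself. *)
have skh := @smooth_at_comp _ _ Y (cline R) V h (f x) _ oV (UV x Ux) sh sk.
have := Dhol _ _ (conj oVW (conj (UV _ Ux) Whfx)) hkh.
by rewrite /Defs.pushforward (asboolT skh).
Qed.

End Pushforward.

(** * Descent of invariant CR maps to the orbit space *)

Theorem mainTheorem3 (R : realType) (d n m : nat)
    (G : lieGroup R d) (X : crManifold R n) (A : lieAction G X)
    (hG : closed_in_complexification G)
    (hcr : cr_action A) (hproper : proper_action A) (htrans : transversal_action A)
    (Y : complexManifold R m) (f : X -> Y)
    (fcr : cr_to_complex_on setT f)
    (finv : forall (g : G) (x : X), f (A g x) = f x) :
  exists! fbar : quotient_space A -> complex_space_of Y,
    holomorphic_map fbar /\ forall x : X, f x = fbar (orbit_proj A x).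
Proof.
(* [f] is evaluated at the chosen representative of the orbit; invariance makes the choice
   immaterial. *)
pose fbar (q : quotient_space A) : Y := f (repr q).
have fbarE x : fbar (orbit_proj A x) = f x.
  have /asboolP[g e] : same_orbit A x (repr (orbit_proj A x)).
    by apply/eqmodP; rewrite reprK.
  by rewrite /fbar e finv.
have fE : fbar \o orbit_proj A = f by apply/funext.
have cf : continuous f by move=> x; exact: (fcr.1.1 x I).
exists fbar; split; first split=> //.
  split.
    apply/(@quotient_continuous _ {eq_quot same_orbit_rel A}).
    by rewrite -[fbar \o _]/(fbar \o orbit_proj A) fE.
  move=> V h oV hh; rewrite /= -comp_preimage -compA fE.
  have oU : open (f @^-1` V) by move/continuousP : cf; exact.
  apply: holo_comp_cr hh => //.
  by split=> [|x D _]; [apply: smooth_on_subset fcr.1|exact: fcr.2].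
(* Uniqueness: each [q] is the projection of [repr q], where [g] is forced to equal [f (repr q)]. *)
move=> g [_ gE]; apply/funext => q.
by rewrite /fbar gE /orbit_proj reprK.
Qed.
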